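(* Let $K$ be a field. For each $n$ let $S=K[x_1,\dots,x_n]$ and let $Z_j=\operatorname{Im}\partial_j$ ($1\leq j\leq n$), where $\partial_\bullet$ is the differential of the Koszul complex on $x_1,\dots,x_n$. (a) Let $i\geq 2$. Then for all $n\gg 0$ there is no multigraded Bourbaki sequence of $Z_i$. (b) Let $j\geq 3$. Then for all $n\gg 0$ there is no multigraded Bourbaki sequence of $Z_{n-j}$.
   Context: The Koszul complex on $x_1,\dots,x_n$ is $0\to K_n\xrightarrow{\partial_n}K_{n-1}\to\cdots\to K_1\xrightarrow{\partial_1}K_0=S$, with $K_j=\bigwedge^j S^n$; the canonical basis of $K_j$ consists of the elements $\mathbf e_{i_1\dots i_j}=\mathbf e_{i_1}\wedge\dots\wedge\mathbf e_{i_j}$, $1\leq i_1<\dots<i_j\leq n$, and $\partial(\mathbf e_{i_1\dots i_j})=\sum_{k=1}^{j}(-1)^{k+1}x_{i_k}\mathbf e_{i_1\dots\widehat{i_k}\dots i_j}$. A Bourbaki sequence of $M$ is a short exact sequence $0\to F\to M\to N\to 0$ with $F$ free and $N$ isomorphic to an ideal of $S$. A multigraded Bourbaki sequence of $Z_i$ means a Bourbaki sequence of the form $0\to F\xrightarrow{\partial_i|_F}Z_i\to Z_i/\partial_i(F)\to 0$, where $F$ is a free submodule of $K_i$ generated by a subset of the canonical basis of $K_i$. *)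

(* Defs.v *)
From HB Require Import structures.
From mathcomp Require Import all_boot all_order all_algebra.
From mathcomp Require Import boolp.
From mathcomp Require Import mpoly.

Set Implicit Arguments.
Unset Strict Implicit.
Unset Printing Implicit Defensive.

Import GRing.Theory.
Local Open Scope ring_scope.
Local Open Scope quotient_scope.

Section Submodule.
Variables (R : nzRingType) (V : lmodType R) (P : submodClosed V).

Record submodule := Submodule { submodule_val : V; _ : submodule_val \in P }.

HB.instance Definition _ := [isSub for submodule_val].
HB.instance Definition _ := [Choice of submodule by <:].
HB.instance Definition _ := [SubChoice_isSubLmodule of submodule by <:].

End Submodule.

Section Image.
Variables (R : nzRingType) (U V : lmodType R) (f : {linear U -> V}).

Definition image_pred : {pred V} := fun y => `[< exists x, f x = y >].

Lemma image_predP y : reflect (exists x, f x = y) (y \in image_pred).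
Proof. exact: asboolP. Qed.

Fact image_submod_closed : submod_closed image_pred.
Proof.
split=> [|a y z /image_predP[u <-] /image_predP[v <-]].
  by apply/image_predP; exists 0; rewrite linear0.
by apply/image_predP; exists (a *: u + v); rewrite linearP.
Qed.

HB.instance Definition _ :=
  GRing.isSubmodClosed.Build R V image_pred image_submod_closed.

Definition image_mod := submodule image_pred.

End Image.

Section Span.
Variables (R : nzRingType) (V : lmodType R) (I : finType) (B : {set I}).
Variable b : I -> V.

Definition span_pred : {pred V} :=
  fun v => `[< exists c : I -> R, v = \sum_(i in B) c i *: b i >].

Lemma span_predP v :
  reflect (exists c : I -> R, v = \sum_(i in B) c i *: b i) (v \in span_pred).
Proof. exact: asboolP. Qed.

Fact span_submod_closed : submod_closed span_pred.
Proof.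
split=> [|a u v /span_predP[c ->] /span_predP[d ->]].
  by apply/span_predP; exists (fun=> 0); rewrite big1 // => i _; rewrite scale0r.
apply/span_predP; exists (fun i => a * c i + d i).
rewrite scaler_sumr -big_split /=; apply: eq_bigr => i _.
by rewrite scalerDl scalerA.
Qed.

HB.instance Definition _ :=
  GRing.isSubmodClosed.Build R V span_pred span_submod_closed.

Definition span_mod := submodule span_pred.

End Span.

Section QuotientModule.
Variables (R : nzRingType) (V : lmodType R) (P : submodClosed V).

Definition quot_ker : {pred V} := fun v => v \in P.

HB.instance Definition _ := GRing.isZmodClosed.Build V quot_ker
  (GRing.submod_closedB (GRing.submodClosedP P)).

Definition quot_mod := Quotient.quot quot_ker.

HB.instance Definition _ := GRing.Zmodule.on quot_mod.

Definition quot_proj (v : V) : quot_mod := \pi_(Quotient.quot quot_ker) v.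

Definition quot_scale (a : R) (q : quot_mod) : quot_mod :=
  quot_proj (a *: repr (q : Quotient.quot quot_ker)).

Lemma quot_projP u v : reflect (quot_proj u = quot_proj v) (u - v \in P).
Proof.
have <- : (u - v \in quot_ker) = (u - v \in P) by [].
by rewrite Quotient.idealrBE; exact: eqP.
Qed.

Lemma quot_reprK (q : quot_mod) : quot_proj (repr (q : Quotient.quot quot_ker)) = q.
Proof. exact: reprK. Qed.

Lemma quot_proj_surj (q : quot_mod) : exists v, quot_proj v = q.
Proof. by exists (repr (q : Quotient.quot quot_ker)); exact: quot_reprK. Qed.

Lemma quot_projD u v : quot_proj (u + v) = quot_proj u + quot_proj v.
Proof. exact: (raddfD \pi_(Quotient.quot quot_ker)). Qed.

Lemma quot_scale_proj a v : quot_scale a (quot_proj v) = quot_proj (a *: v).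
Proof.
apply/quot_projP; rewrite -scalerBr rpredZ //; apply/quot_projP.
exact: quot_reprK.
Qed.

Fact quot_scaleA a b q : quot_scale a (quot_scale b q) = quot_scale (a * b) q.
Proof. by case: (quot_proj_surj q) => v <-; rewrite !quot_scale_proj scalerA. Qed.

Fact quot_scale1 : left_id 1 quot_scale.
Proof.
by move=> q; case: (quot_proj_surj q) => v <-; rewrite quot_scale_proj scale1r.
Qed.

Fact quot_scaleDr : right_distributive quot_scale +%R.
Proof.
move=> a p q; case: (quot_proj_surj p) (quot_proj_surj q) => u <- [v <-].
by rewrite -quot_projD !quot_scale_proj scalerDr quot_projD.
Qed.

Fact quot_scaleDl q : {morph quot_scale^~ q : a b / a + b}.
Proof.
move=> a b; case: (quot_proj_surj q) => v <-.
by rewrite !quot_scale_proj scalerDl quot_projD.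
Qed.

HB.instance Definition _ := GRing.Zmodule_isLmodule.Build R quot_mod
  quot_scaleA quot_scale1 quot_scaleDr quot_scaleDl.

Fact quot_proj_linear : linear quot_proj.
Proof. by move=> a u v; rewrite quot_projD -quot_scale_proj. Qed.

HB.instance Definition _ :=
  GRing.isLinear.Build R V quot_mod _ quot_proj quot_proj_linear.

End QuotientModule.

Section Bourbaki.
Variable R : comNzRingType.

Definition is_basis (V : lmodType R) (I : eqType) (b : I -> V) : Prop :=
  (forall (s : seq I) (c : I -> R), uniq s ->
     \sum_(i <- s) c i *: b i = 0 -> {in s, forall i, c i = 0}) /\
  (forall v, exists (s : seq I) (c : I -> R), v = \sum_(i <- s) c i *: b i).

Definition is_free (V : lmodType R) : Prop :=
  exists (I : eqType) (b : I -> V), is_basis b.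

Definition short_exact (U V W : lmodType R)
    (f : {linear U -> V}) (g : {linear V -> W}) : Prop :=
  [/\ injective f,
      forall v, g v = 0 <-> exists u, f u = v
    & forall w, exists v, g v = w].

(* An ideal of R is a submodule of the regular module R^o; the library's
   [idealr] is not used since it excludes the unit ideal. *)
Definition isomorphic_to_ideal (N : lmodType R) : Prop :=
  exists (J : submodClosed R^o) (h : {linear N -> submodule J}), bijective h.

Definition is_bourbaki_sequence (F M N : lmodType R)
    (f : {linear F -> M}) (g : {linear M -> N}) : Prop :=
  [/\ short_exact f g, is_free F & isomorphic_to_ideal N].

End Bourbaki.

Section Koszul.
Variables (K : fieldType) (n : nat).
Local Notation S := {mpoly K[n]}.

(* The set {i_1 < ... < i_j} indexes e_{i_1 ... i_j}; indices start at 0. *)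
Definition jsubset (j : nat) := {A : {set 'I_n} | #|A| == j}.

(* The regular module S^o makes [koszul j] a module over S, not over K. *)
Definition koszul (j : nat) := {ffun jsubset j -> S^o}.

HB.instance Definition _ j := GRing.Lmodule.on (koszul j).

(* [koszul_e j A] is e_A when #|A| = j, and the junk value 0 otherwise. *)
Definition koszul_e (j : nat) (A : {set 'I_n}) : koszul j :=
  [ffun B : jsubset j => (val B == A)%:R].

(* If k = i_m, then [#|[set l in A | l < k]|] is m - 1, of the parity of m + 1. *)
Definition koszul_d_e (j : nat) (A : {set 'I_n}) : koszul j.-1 :=
  \sum_(k in A)
    ((-1) ^+ #|[set l in A | (l < k)%N]| * 'X_k : S) *: koszul_e j.-1 (A :\ k).

(* For j = 0 this is the zero map. *)
Definition koszul_d (j : nat) (w : koszul j) : koszul j.-1 :=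
  \sum_(A : jsubset j) (w A : S) *: koszul_d_e j (val A).

Fact koszul_d_linear j : linear (@koszul_d j).
Proof.
move=> a u v; rewrite /koszul_d scaler_sumr -big_split /=.
by apply: eq_bigr => A _; rewrite !ffunE scalerDl scalerA.
Qed.

HB.instance Definition _ j := GRing.isLinear.Build S (koszul j) (koszul j.-1) _
  (@koszul_d j) (@koszul_d_linear j).

Definition koszul_Z (i : nat) := image_mod (@koszul_d i).

Section Multigraded.
Variables (i : nat) (B : {set jsubset i}).

Definition koszul_F := span_mod B (fun A : jsubset i => koszul_e i (val A)).

Definition koszul_dF (w : koszul_F) : koszul_Z i :=
  Submodule (introT (image_predP (@koszul_d i) _)
                    (ex_intro _ (val w) (erefl (koszul_d (val w))))).

Fact koszul_dF_linear : linear koszul_dF.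
Proof. by move=> a u v; apply: val_inj; rewrite /= !linearP. Qed.

HB.instance Definition _ := GRing.isLinear.Build S koszul_F (koszul_Z i) _
  koszul_dF koszul_dF_linear.

End Multigraded.

Definition has_multigraded_bourbaki_sequence (i : nat) : Prop :=
  exists B : {set jsubset i},
    is_bourbaki_sequence (@koszul_dF i B)
                         (@quot_proj S (koszul_Z i) (image_pred (@koszul_dF i B))).

End Koszul.

(* Main.v *)
Require Import Defs.
From HB Require Import structures.
From mathcomp Require Import all_boot all_order all_algebra.
From mathcomp Require Import mpoly zify ring.

(** Suppose that F, spanned by the basis elements e_A with A in a family B of
i-subsets of {1, ..., n} (the faces), gives a Bourbaki sequence of Z_i. Two
bounds on #|B| contradict each other for the relevant n.

Upper bound ([leq_card_acyclic], [acyclic_supported]). Everything is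
multigraded, so a linear dependence over K between the simplicial boundaries of
the faces can be homogenized into an element of F killed by the Koszul
differential. Injectivity on F thus makes these boundaries independent. They
are cycles, and a cycle on {1, ..., n} is determined by its values on the sets
that avoid a fixed vertex, because a simplex is a cone; hence
#|B| <= 'C(n-1, i-1).

Lower bound ([no_three_nonfaces], [leq_faces_double_count]). Compose
K_i -> Z_i -> Z_i/F with an embedding of Z_i/F into S: this is a linear map phi
whose kernel is F + ker(d) ([bourbaki_ideal_map]). A non-face A has
phi(e_A) <> 0, because all relations between the generators of Z_i/F have
coefficients in the maximal ideal ([generator_neq0]). Let A1 and A2 be two
non-faces obtained from an (i+1)-set C by removing k1 and k2. Their images in
the ring S satisfy a trivial relation; a multihomogeneous part of it, divided
by a monomial (S is a domain), is a relation between x_k2 e_A2 and x_k1 e_A1 of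
multidegree C ([linear_syzygy]). In that multidegree, however, the relations of
Z_i/F are the multiples of d(e_C), which involve every non-face contained in C.
So C contains at most two non-faces, that is, at least i-1 faces, and double
counting gives (i-1) 'C(n, i+1) <= (n-i) #|B|.

Together, (i-1) n <= i (i+1) when i < n ([bourbaki_bound]). For fixed i >= 2
this bounds n, and for i = n-j it reads (j-2) n <= j (j-1), which bounds n as
soon as j >= 3. *)

Set Implicit Arguments.
Unset Strict Implicit.
Unset Printing Implicit Defensive.

Import GRing.Theory.
Local Open Scope ring_scope.

(** * Simplicial boundaries *)

Section Chains.
Variables (n : nat) (R : comNzRingType).
Implicit Types (D : {set 'I_n}) (k l : 'I_n) (v : {set 'I_n} -> R).

(** Signs are indexed by the smaller set D and the vertex k added to it; as k
is not below itself, this is the sign of D in the boundary of k |: D. *)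
Definition face_sign D k : R := (-1) ^+ #|[set l in D | (l < k)%N]|.

Definition boundary v D : R := \sum_(k | k \notin D) face_sign D k * v (k |: D).

Lemma face_signU1 D k l :
  l \notin D -> face_sign (l |: D) k = (-1) ^+ (l < k)%N * face_sign D k.
Proof.
move=> lD; rewrite /face_sign -exprD; congr (_ ^+ _).
case: (boolP (l < k)%N) => lk /=.
  rewrite (_ : [set _ in _ | _] = l |: [set x in D | (x < k)%N]).
    by rewrite cardsU1 inE (negPf lD).
  by apply/setP=> x; rewrite !inE; case: eqVneq => [->|] //=; rewrite lk.
congr #|pred_of_set _|; apply/setP=> x; rewrite !inE.
by case: eqVneq => [->|] //=; rewrite (negPf lk) (negPf lD).
Qed.

(** Adding k < l to D in the two possible orders gives opposite signs: only the
sign of l sees the other vertex. *)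
Lemma boundary_boundary v D : boundary (boundary v) D = 0.
Proof.
rewrite /boundary; under eq_bigr do rewrite mulr_sumr.
rewrite pair_big_dep /=.
pose P := fun p : 'I_n * 'I_n => (p.1 \notin D) && (p.2 \notin p.1 |: D).
have swapK : involutive (fun p : 'I_n * 'I_n => (p.2, p.1)) by case.
rewrite (bigID (fun p : 'I_n * 'I_n => (p.1 < p.2)%N)) /=.
rewrite [X in _ + X](reindex_inj (can_inj swapK)) /=.
rewrite [X in _ + X](eq_bigl (fun p => [&& P p & (p.1 < p.2)%N])); last first.
  move=> [k l]; rewrite /P /= !inE !negb_or -leqNgt leq_eqVlt.
  rewrite (inj_eq val_inj) [l == k]eq_sym.
  by case: eqVneq => //= _; case: (k \in D); case: (l \in D).
rewrite -big_split big1 // => -[k l] /=.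
rewrite !inE negb_or => /andP[/and3P[kD lk lD] kl].
rewrite !face_signU1 // 1?eq_sym // kl ltnNge ltnW //= expr1 expr0.
rewrite (setUCA [set l]); ring.
Qed.

End Chains.

(** * Coordinates and multigraded parts of Koszul chains *)

Section KoszulCoefficients.
Variables (K : fieldType) (n : nat).
Local Notation S := {mpoly K[n]}.
Implicit Types (D A : {set 'I_n}) (k l : 'I_n) (p q : S) (m d : 'X_{1..n}).

(** Coordinates are indexed by all subsets, with value 0 on those of the wrong
size, which avoids subtypes in the indices of sums. *)
Definition kcoef j (w : koszul K n j) A : S := oapp w 0 (insub A).

Definition chain j (f : {set 'I_n} -> S) : koszul K n j :=
  [ffun A : jsubset n j => f (val A)].

Lemma kcoef_val j (w : koszul K n j) (A : jsubset n j) : kcoef w (val A) = w A.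
Proof. by rewrite /kcoef valK. Qed.

Lemma kcoef_chain j f A : #|A| = j -> kcoef (chain j f) A = f A.
Proof. by move=> /eqP cA; rewrite /kcoef insubT /= ffunE. Qed.

Lemma koszul_dE j (w : koszul K n j.+1) (D : jsubset n j) :
  koszul_d w D
  = \sum_(k | k \notin val D) face_sign S (val D) k * 'X_k * kcoef w (k |: val D).
Proof.
have term (A : jsubset n j.+1) : (w A *: koszul_d_e K j.+1 (val A)) D
    = \sum_k if k \in val A then
        w A * (face_sign S (val A) k * 'X_k * (val D == val A :\ k)%:R) else 0.
  rewrite /koszul_d_e ffunE sum_ffunE scaler_sumr big_mkcond.
  by apply: eq_bigr => k _; rewrite !ffunE.
rewrite /koszul_d sum_ffunE [LHS](eq_bigr _ (fun (A : jsubset n j.+1) _ => term A)).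
rewrite exchange_big /= [RHS]big_mkcond; apply: eq_bigr => k _.
case: ifPn => kD; last first.
  apply: big1 => A _; case: ifP => // kA.
  case: eqP => [eD|_]; last by rewrite !mulr0.
  by rewrite eD !inE eqxx in kD.
have cE : #|k |: val D| == j.+1 by rewrite cardsU1 kD (eqP (valP D)).
pose E : jsubset n j.+1 := Sub (k |: val D) cE.
rewrite (bigD1 E) //= setU11 big1 ?addr0 => [|A nAE].
  rewrite setU1K // eqxx mulr1 mulrC -(kcoef_val w E) /=; congr (_ * _ * _).
  congr (_ ^+ #|pred_of_set _|).
  by apply/setP=> l; rewrite !inE; case: eqVneq => [->|] //=; rewrite ltnn andbF.
case: ifP => // kA; case: eqP => [eD|_]; last by rewrite !mulr0.
by case/eqP: nAE; apply: val_inj; rewrite /= eD setD1K.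
Qed.

Lemma mcoeffMXU p l m :
  (p * 'X_l)@_m = if m l == 0%N then 0 else p@_(m - U_(l)).
Proof.
case: ifPn => [ml|ml]; last first.
  have le : (U_(l) <= m)%MM by rewrite lep1mP.
  by rewrite -{1}(submK le) addmC mcoeffMX.
apply/eqP; rewrite mcoeff_eq0 (perm_mem (msuppMX _ _)).
apply/mapP=> -[m' _ em]; move: ml; rewrite em mnmDE mnm1E eqxx; lia.
Qed.

Lemma kcoefP j (u w : koszul K n j) : kcoef u =1 kcoef w -> u = w.
Proof. by move=> e; apply/ffunP=> A; rewrite -!kcoef_val e. Qed.

Lemma kcoef_linear j a (u w : koszul K n j) A :
  kcoef (a *: u + w) A = a * kcoef u A + kcoef w A.
Proof. by rewrite /kcoef; case: insub => [B|] /=; rewrite ?ffunE // mulr0 addr0. Qed.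

Lemma kcoef_card j (w : koszul K n j) A : #|A| != j -> kcoef w A = 0.
Proof. by move=> cA; rewrite /kcoef insubF //; apply: negbTE. Qed.

Lemma kcoef_koszul_e j A A' : #|A'| = j -> kcoef (koszul_e K j A) A' = (A' == A)%:R.
Proof. exact: (@kcoef_chain j (fun A' => (A' == A)%:R)). Qed.

Lemma kcoef_koszul_d j (w : koszul K n j.+1) D : #|D| = j ->
  kcoef (koszul_d w : koszul K n j) D
  = \sum_(k | k \notin D) face_sign S D k * 'X_k * kcoef w (k |: D).
Proof. by move=> /eqP cD; rewrite {1}/kcoef insubT /= koszul_dE. Qed.

Lemma mcoeff_koszul_d j (w : koszul K n j.+1) D m : #|D| = j ->
  (kcoef (koszul_d w : koszul K n j) D)@_m
  = \sum_(l | (l \notin D) && (m l != 0%N))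
       face_sign K D l * (kcoef w (l |: D))@_(m - U_(l)).
Proof.
move=> cD; rewrite kcoef_koszul_d // raddf_sum big_mkcondr; apply: eq_bigr => l _ /=.
rewrite -mulrA raddfMsign /= mulrC [in 'X_l * _]mulrC mcoeffMXU mulrC.
by case: eqP => //= _; rewrite mulr0.
Qed.

Definition indicator A : 'X_{1..n} := [multinom (k \in A : nat) | k < n].

Lemma indicatorU1 A k : k \notin A -> indicator (k |: A) = (U_(k) + indicator A)%MM.
Proof.
move=> kA; apply/mnmP=> l; rewrite mnmDE mnm1E !mnmE !inE.
by rewrite eq_sym; case: eqVneq kA => //= -> /negPf ->.
Qed.

(** The basis element e_A has multidegree [indicator A]; this is the term
of p that makes p e_A homogeneous of multidegree d. *)
Definition degpart d A p : S :=
  if (indicator A <= d)%MM then p@_(d - indicator A) *: 'X_[(d - indicator A)] else 0.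

Fact degpart_linear d A : linear (degpart d A).
Proof.
move=> c p q; rewrite /degpart; case: ifP => _; last by rewrite scaler0 addr0.
by rewrite mcoeffD mcoeffZ scalerDl scalerA.
Qed.

HB.instance Definition _ d A :=
  GRing.isLinear.Build K S S _ (degpart d A) (@degpart_linear d A).

Lemma mcoeff_degpart d A p m :
  (degpart d A p)@_m = if (m + indicator A == d)%MM then p@_m else 0.
Proof.
rewrite /degpart; case: eqP => [<-|ne].
  by rewrite lem_addl addmK mcoeffZ mcoeffX eqxx mulr1.
case: ifP => [le|_]; last by rewrite mcoeff0.
rewrite mcoeffZ mcoeffX; case: eqP => [e|_]; last by rewrite mulr0.
by case: ne; rewrite -e submK.
Qed.

Lemma degpartMX d D k p :
  k \notin D -> degpart d D (p * 'X_k) = degpart d (k |: D) p * 'X_k.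
Proof.
move=> kD; apply/mpolyP=> m; rewrite mcoeff_degpart !mcoeffMXU mcoeff_degpart.
case: (eqVneq (m k)) => [_|mk]; first by rewrite if_same.
by rewrite indicatorU1 // addmA submK // lep1mP.
Qed.

Definition koszul_degpart j d (w : koszul K n j) : koszul K n j :=
  chain j (fun A => degpart d A (kcoef w A)).

Lemma kcoef_degpart j d (w : koszul K n j) A :
  kcoef (koszul_degpart d w) A = degpart d A (kcoef w A).
Proof.
have [cA|cA] := eqVneq #|A| j; first exact: kcoef_chain.
by rewrite !kcoef_card // linear0.
Qed.

(** The differential preserves multidegrees. *)
Lemma koszul_d_degpart j d (w : koszul K n j.+1) :
  koszul_d (koszul_degpart d w) = koszul_degpart d (koszul_d w : koszul K n j).
Proof.
apply: kcoefP => D; have [cD|cD] := eqVneq #|D| j; last by rewrite !kcoef_card.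
rewrite kcoef_koszul_d // kcoef_degpart kcoef_koszul_d //.
rewrite linear_sum; apply: eq_bigr => k kD.
rewrite -!mulrA raddfMsign /= kcoef_degpart; congr (_ * _).
by rewrite mulrC -degpartMX // mulrC.
Qed.

Lemma kcoef0 j A : kcoef (0 : koszul K n j) A = 0.
Proof. by rewrite /kcoef; case: insub => //= B; rewrite ffunE. Qed.

Lemma kcoefZ j a (w : koszul K n j) A : kcoef (a *: w) A = a * kcoef w A.
Proof. by rewrite -[a *: w]addr0 kcoef_linear kcoef0 addr0. Qed.

Lemma kcoef_e2 j (a b : S) (A A' E : {set 'I_n}) : #|E| = j ->
  kcoef (a *: koszul_e K j A + b *: koszul_e K j A') E
  = a * (E == A)%:R + b * (E == A')%:R.
Proof. by move=> cE; rewrite kcoef_linear kcoefZ !kcoef_koszul_e. Qed.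

Lemma koszul_degpart_e2 j d (a b : S) A A' :
  koszul_degpart d (a *: koszul_e K j A + b *: koszul_e K j A')
  = degpart d A a *: koszul_e K j A + degpart d A' b *: koszul_e K j A'.
Proof.
have partb p E (t : bool) F : (t -> E = F) ->
    degpart d E (p * t%:R) = degpart d F p * t%:R.
  by case: t => [->|_]; rewrite ?mulr1 ?mulr0 ?linear0.
apply: kcoefP => E; apply: etrans (kcoef_degpart _ _ _) _.
have [cE|cE] := eqVneq #|E| j; last first.
  apply: etrans (congr1 (degpart d E) (kcoef_card _ cE)) _.
  by apply: etrans _ (esym (kcoef_card _ cE)); rewrite linear0.
apply: etrans (congr1 (degpart d E) (kcoef_e2 a b A A' cE)) _.
apply: etrans _ (esym (kcoef_e2 _ _ _ _ cE)).
by rewrite (linearD (degpart d E)); congr (_ + _); apply: partb => /eqP.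
Qed.

Lemma degpart_monomial m A p : degpart (m + indicator A) A p = p@_m *: 'X_[m].
Proof. by rewrite /degpart lem_addl addmK. Qed.

End KoszulCoefficients.

(** * From a Bourbaki sequence to a functional on the Koszul module *)

Lemma quot_proj_eq0 (R : nzRingType) (V : lmodType R) (P : submodClosed V) v :
  reflect (quot_proj P v = 0) (v \in P).
Proof. by have := quot_projP P v 0; rewrite subr0 linear0. Qed.

(** Composing the projection with the embedding gives a functional on M itself,
so that no element of the quotient has to be named later on. *)
Lemma quot_ideal_functional (R : comNzRingType) (M : lmodType R) (P : submodClosed M) :
    isomorphic_to_ideal (quot_mod P) ->
  exists2 psi : M -> R, (forall a x y, psi (a *: x + y) = a * psi x + psi y)
                      & forall x, psi x = 0 <-> x \in P.
Proof.
case=> J [h /bij_inj inj_h].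
exists (fun x => submodule_val (h (quot_proj P x))) => [a x y|x].
  by rewrite (linearP (quot_proj P)) (linearP h).
split=> [hx|/quot_proj_eq0 ->]; last by rewrite linear0.
by apply/quot_proj_eq0/inj_h/val_inj; rewrite linear0.
Qed.

Lemma bourbaki_injective (R : comNzRingType) (F M N : lmodType R)
    (f : {linear F -> M}) (g : {linear M -> N}) :
  is_bourbaki_sequence f g -> injective f.
Proof. by case=> -[]. Qed.

Lemma bourbaki_ideal (R : comNzRingType) (F M N : lmodType R)
    (f : {linear F -> M}) (g : {linear M -> N}) :
  is_bourbaki_sequence f g -> isomorphic_to_ideal N.
Proof. by case. Qed.

Section Support.
Variables (K : fieldType) (n i : nat) (B : {set jsubset n i}).
Local Notation S := {mpoly K[n]}.
Implicit Types (A C D : {set 'I_n}) (u w : koszul K n i).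

Definition faces : {set {set 'I_n}} := [set val A | A in B].

Definition supported w := forall A, A \notin faces -> kcoef w A = 0.

Lemma mem_faces (A : jsubset n i) : (val A \in faces) = (A \in B).
Proof. exact/mem_imset/val_inj. Qed.

Lemma card_faces A : A \in faces -> #|A| = i.
Proof. by case/imsetP=> -[A' /= /eqP cA'] _ ->. Qed.

Lemma scale_koszul_eE (c : S) (A A' : jsubset n i) :
  (c *: koszul_e K i (val A')) A = c * (A == A')%:R.
Proof. by rewrite !ffunE (inj_eq val_inj). Qed.

Lemma supported_span w :
  w \in span_pred B (fun A : jsubset n i => koszul_e K i (val A)) <-> supported w.
Proof.
split=> [/span_predP[c ->] A AB|sw].
  have [cA|] := eqVneq #|A| i; last exact: kcoef_card.
  pose A' : jsubset n i := Sub A (introT eqP cA).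
  rewrite -[A]/(val A') kcoef_val sum_ffunE big1 // => A'' A''B.
  rewrite scale_koszul_eE; case: eqP => [eA|]; last by rewrite mulr0.
  by rewrite -[A]/(val A') mem_faces eA A''B in AB.
apply/span_predP; exists w; apply/ffunP=> A.
rewrite sum_ffunE big_mkcond (bigD1 A) //= big1 => [|A' /negPf nA].
  case: ifPn => [_|nA]; first by rewrite scale_koszul_eE eqxx mulr1 addr0.
  by rewrite -kcoef_val sw ?mem_faces // addr0.
by rewrite scale_koszul_eE eq_sym nA mulr0 if_same.
Qed.

(** phi factors through Z_i and identifies the quotient by the image of F with
an ideal of S. *)
Definition ideal_map (phi : koszul K n i -> S) : Prop :=
  (forall a u w, phi (a *: u + w) = a * phi u + phi w) /\
  (forall u, phi u = 0 <-> exists2 w, supported w & koszul_d w = koszul_d u).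

End Support.

Lemma bourbaki_ideal_map (K : fieldType) (n i : nat) :
  has_multigraded_bourbaki_sequence K n i ->
  exists B : {set jsubset n i},
    (forall w : koszul K n i, supported B w -> koszul_d w = 0 -> w = 0) /\
    exists phi : koszul K n i -> {mpoly K[n]}, ideal_map B phi.
Proof.
case=> B bourbaki; exists B.
have inj_d := bourbaki_injective bourbaki.
have ideal_N := bourbaki_ideal bourbaki.
have [psi psiD psi0] := quot_ideal_functional ideal_N.
split=> [w /supported_span sw dw|].
  have /(congr1 val) //: Submodule sw = 0 :> koszul_F K B.
  by apply: inj_d; apply: val_inj; rewrite linear0.
have imP u : koszul_d u \in image_pred (@koszul_d K n i).
  by apply/image_predP; exists u.
pose z u : koszul_Z K n i := Submodule (imP u).
have zL a u w : z (a *: u + w) = a *: z u + z w.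
  by apply: val_inj; exact: linearP.
exists (fun u => psi (z u)); split=> [a u w|u]; first by rewrite zL psiD.
apply: (iff_trans (psi0 _)).
split=> [/image_predP[[w sw] /(congr1 val)/= dw]|[w sw dw]].
  move/supported_span: (sw) => sw'; exact: (ex_intro2 _ _ w sw' dw).
move/supported_span: (sw) => sw'; apply/image_predP.
exists (Submodule sw'); apply: val_inj; exact: dw.
Qed.

(** * Each (i+1)-set contains at most two non-faces *)

Section Sequence.
Variables (K : fieldType) (n j : nat) (B : {set jsubset n j.+1}).
Local Notation S := {mpoly K[n]}.
Implicit Types (A C D : {set 'I_n}) (u w : koszul K n j.+1).

(** Let u be a cycle modulo F. At a monomial m for which every contributing set
l |: D is a non-face, F has no part in the differential, so the contributions of
u cancel among themselves; when only that of k |: D is left, it vanishes. *)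
Lemma mcoeff_cycle_eq0 u w D k (m : 'X_{1..n}) :
    supported B w -> koszul_d w = koszul_d u ->
    (forall l, l \notin D -> m l != 0%N -> l |: D \notin faces B) ->
    (forall l, l \notin D -> m l != 0%N -> l != k -> kcoef u (l |: D) = 0) ->
    #|D| = j -> k \notin D -> m k != 0%N ->
  (kcoef u (k |: D))@_(m - U_(k)) = 0.
Proof.
move=> sw dw out u0 cD kD mk.
have : (kcoef (koszul_d u : koszul K n j) D)@_m = 0.
  apply: etrans (congr1 (fun v : koszul K n j => (kcoef v D)@_m) (esym dw)) _.
  apply: etrans (mcoeff_koszul_d w m cD) _; apply: big1 => l /andP[lD ml].
  by rewrite (sw _ (out l lD ml)) mcoeff0 mulr0.
rewrite (mcoeff_koszul_d u m cD) (bigD1 k) /=; last by rewrite kD mk.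
rewrite big1 => [|l /andP[/andP[lD ml] lk]]; last first.
  by rewrite (u0 l lD ml lk) mcoeff0 mulr0.
by rewrite addr0 => /eqP; rewrite mulf_eq0 signr_eq0 => /eqP.
Qed.

Variable phi : koszul K n j.+1 -> S.
Hypothesis phiP : ideal_map B phi.

Lemma ideal_map0 : phi 0 = 0.
Proof. apply/phiP.2; exists 0 => [A _|]; [exact: kcoef0 | exact: erefl]. Qed.

Lemma ideal_mapZ a u : phi (a *: u) = a * phi u.
Proof. by rewrite -[a *: u]addr0 phiP.1 ideal_map0 addr0. Qed.

Lemma ideal_mapD a b u w : phi (a *: u + b *: w) = a * phi u + b * phi w.
Proof. by rewrite phiP.1 ideal_mapZ. Qed.

(** At D = A :\ k and the monomial x_k, the only possible contribution to the
differential of e_A is the unit coefficient of e_A itself. *)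
Lemma generator_neq0 A :
  #|A| = j.+1 -> A \notin faces B -> phi (koszul_e K j.+1 A) != 0.
Proof.
move=> cA AB; apply/eqP=> /phiP.2[w sw dw].
have /card_gt0P[k kA]: (0 < #|A|)%N by rewrite cA.
have cD : #|A :\ k| = j by apply/eq_add_S; rewrite -cA (cardsD1 k A) kA.
have mk l : U_(k)%MM l != 0%N -> l = k.
  by rewrite mnm1E; case: (k =P l) => // ->.
have kD : k \notin A :\ k by rewrite !inE eqxx.
have mkk : (U_(k) - U_(k) = 0)%MM by apply/mnmP=> l; rewrite mnmBE subnn mnm0E.
have /eqP : (kcoef (koszul_e K j.+1 A) (k |: A :\ k))@_(U_(k) - U_(k)) = 0.
  apply: (mcoeff_cycle_eq0 sw dw _ _ cD kD) => [l _ /mk ->|l _ /mk -> /eqP|].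
  - by rewrite setD1K.
  - by move=> ne; case: ne.
  - by rewrite mnm1E eqxx.
rewrite (setD1K kA) (kcoef_koszul_e K A cA) eqxx mkk mcoeff1 eqxx.
by rewrite oner_eq0.
Qed.

(** F is spanned by homogeneous elements, so the kernel F + ker(d) of phi is
multigraded. *)
Lemma ideal_map_degpart d u : phi u = 0 -> phi (koszul_degpart d u) = 0.
Proof.
move=> /phiP.2[w sw dw]; apply/phiP.2; exists (koszul_degpart d w).
  by move=> A AB; rewrite kcoef_degpart (sw _ AB) linear0.
by rewrite !koszul_d_degpart dw.
Qed.

(** The images p and q of e_A1 and e_A2 are nonzero and p * q - q * p = 0, so
p e_A2 - q e_A1 is in the kernel of phi. The multihomogeneous part through the
leading monomial of p is divisible by a monomial, with a quotient of
multidegree C. *)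
Lemma linear_syzygy C k1 k2 :
    #|C| = j.+2 -> k1 \in C -> k2 \in C -> k1 != k2 ->
    C :\ k1 \notin faces B -> C :\ k2 \notin faces B ->
  exists2 c : K, c != 0 & exists c' : K,
    phi ((c *: 'X_k2) *: koszul_e K j.+1 (C :\ k2)
         + (c' *: 'X_k1) *: koszul_e K j.+1 (C :\ k1)) = 0.
Proof.
move=> cC k1C k2C k12; set A1 := C :\ k1; set A2 := C :\ k2 => A1B A2B.
have cA1 : #|A1| = j.+1 by apply/eq_add_S; rewrite -cC (cardsD1 k1 C) k1C.
have cA2 : #|A2| = j.+1 by apply/eq_add_S; rewrite -cC (cardsD1 k2 C) k2C.
have X_neq0 (m' : 'X_{1..n}) : 'X_[K, m'] != 0.
  by apply/eqP=> /(congr1 (mcoeff m'))/eqP; rewrite mcoeffX eqxx mcoeff0 oner_eq0.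
have p0 := generator_neq0 cA1 A1B; have q0 := generator_neq0 cA2 A2B.
set p := phi _ in p0; set q := phi _ in q0.
have pq0 : phi (p *: koszul_e K j.+1 A2 + (- q) *: koszul_e K j.+1 A1) = 0.
  by apply: etrans (ideal_mapD _ _ _ _) _; rewrite -/p -/q mulNr mulrC addrN.
pose m := mlead p.
have cp0 : p@_m != 0 by rewrite mleadc_eq0.
have := ideal_map_degpart (m + indicator A2)%MM pq0.
rewrite koszul_degpart_e2 degpart_monomial => pq_m.
have {pq_m} := etrans (esym (ideal_mapD _ _ _ _)) pq_m; rewrite -/p -/q.
(* Without x_k2 in m the e_A1 part would vanish, leaving a torsion element. *)
have [mk2|mk2] := eqVneq (m k2) 0%N.
  have -> : degpart (m + indicator A2) A1 (- q) = 0.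
    rewrite /degpart ifN //; apply/mnm_lepP => /(_ k2).
    by rewrite mnmDE !mnmE mk2 !inE eqxx eq_sym k12 k2C.
  rewrite mul0r addr0 => /eqP; rewrite mulf_eq0 (negPf q0) orbF.
  by rewrite -mul_mpolyC mulf_eq0 mpolyC_eq0 (negPf cp0) (negPf (X_neq0 _)).
have [r mE] : exists r, m = (r + U_(k2))%MM.
  by exists (m - U_(k2))%MM; rewrite submK // lep1mP.
have -> : (m + indicator A2 = (r + U_(k1)) + indicator A1)%MM.
  by rewrite mE -!addmA -!indicatorU1 ?setD1K // !inE eqxx.
rewrite degpart_monomial => phi_r.
exists p@_m => //; exists (- q)@_(r + U_(k1)).
apply: etrans (ideal_mapD _ _ _ _) _; rewrite -/p -/q.
apply: (@mulfI _ 'X_[K, r]); first exact: X_neq0.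
rewrite mulr0 -{}phi_r mE !mpolyXD -!mul_mpolyC; ring.
Qed.

(** Take the linear syzygy between the first two non-faces. Its differential at
D = C :\ k2 :\ k3 contains the monomial x_k2 x_k3 only through e_(C :\ k2),
since C :\ k3 is a non-face on which the syzygy has no term. *)
Lemma no_three_nonfaces C k1 k2 k3 :
    #|C| = j.+2 -> [/\ k1 \in C, k2 \in C & k3 \in C] ->
    [/\ k1 != k2, k2 != k3 & k3 != k1] ->
  [|| C :\ k1 \in faces B, C :\ k2 \in faces B | C :\ k3 \in faces B].
Proof.
move=> cC [k1C k2C k3C] [k12 k23 k31].
apply: contraT; rewrite !negb_or => /and3P[A1B A2B A3B].
have cA x : x \in C -> #|C :\ x| = j.+1.
  by move=> xC; apply/eq_add_S; rewrite -cC (cardsD1 x C) xC.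
have neA x y : x \in C -> x != y -> (C :\ y == C :\ x) = false.
  move=> xC xy; apply: contraNF xy => /eqP/setP/(_ x).
  by rewrite !inE xC eqxx andbT => /negbFE.
have k13 : k1 != k3 by rewrite eq_sym.
pose D := C :\ k2 :\ k3.
have k3A2 : k3 \in C :\ k2 by rewrite !inE eq_sym k23.
have UA2 : k3 |: D = C :\ k2 by rewrite setD1K.
have UA3 : k2 |: D = C :\ k3.
  apply/setP=> x; rewrite !inE; case: (x =P k2) => [->|] //=.
  by rewrite k23 k2C.
have cD : #|D| = j by apply/eq_add_S; rewrite -(cA k2) // (cardsD1 k3 (C :\ k2)) k3A2.
have k3D : k3 \notin D by rewrite !inE eqxx.
have mE l : (U_(k2) + U_(k3))%MM l != 0%N -> l = k2 \/ l = k3.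
  by rewrite mnmDE !mnm1E; case: (k2 =P l) => [|_]; [left|case: (k3 =P l); [right|]].
have [c c0 [c' /phiP.2[w sw dw]]] := linear_syzygy cC k1C k2C k12 A1B A2B.
have : (kcoef ((c *: 'X_k2) *: koszul_e K j.+1 (C :\ k2)
               + (c' *: 'X_k1) *: koszul_e K j.+1 (C :\ k1))
              (k3 |: D))@_(U_(k2) + U_(k3) - U_(k3)) = 0.
  apply: (mcoeff_cycle_eq0 sw dw _ _ cD k3D).
  - by move=> l _ /mE[] ->; rewrite ?UA2 ?UA3.
  - move=> l _ /mE[] -> ne; last by rewrite eqxx in ne.
    apply: etrans (kcoef_e2 _ _ _ _ _) _; first by rewrite UA3 cA.
    by rewrite UA3 (neA k2 k3 k2C k23) (neA k1 k3 k1C k13) !mulr0 addr0.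
  - by rewrite mnmDE mnm1E mnm1E eqxx addn1.
rewrite addmK UA2 (kcoef_e2 _ _ _ _ (cA k2 k2C)) eqxx (neA k1 k2 k1C k12).
rewrite mulr1 mulr0 addr0.
by rewrite mcoeffZ mcoeffX eqxx mulr1 => /eqP; rewrite (negPf c0).
Qed.

Lemma card_faces_in C :
  #|C| = j.+2 -> (j <= #|[set k in C | C :\ k \in faces B]|)%N.
Proof.
move=> cC; rewrite -(leq_add2r 2) addn2 -cC -(cardsID [set k | C :\ k \in faces B] C).
rewrite -!setIdE leq_add2l leqNgt; apply/negP => /card_gt2P[x [y [z [[]]]]].
rewrite !inE => /andP[nx xC] /andP[ny yC] /andP[nz zC] xyz.
have := no_three_nonfaces cC (And3 xC yC zC) xyz.
by rewrite (negPf nx) (negPf ny) (negPf nz).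
Qed.

End Sequence.

(** * Counting faces *)

(** Both sides bound the number of pairs (C, k) with k in C and C :\ k in F,
which correspond to pairs of a face and a vertex outside it. *)
Lemma leq_faces_double_count n j (F : {set {set 'I_n}}) :
    (forall A, A \in F -> #|A| = j.+1) ->
    (forall C : {set 'I_n}, #|C| = j.+2 -> (j <= #|[set k in C | C :\ k \in F]|)%N) ->
  (j * 'C(n, j.+2) <= #|F| * (n - j.+1))%N.
Proof.
move=> cF dense.
pose b (C : {set 'I_n}) k := [&& #|C| == j.+2, k \in C & C :\ k \in F].
apply: (@leq_trans (\sum_(C : {set 'I_n}) \sum_(k < n) b C k)%N).
  rewrite -[X in 'C(X, _)](card_ord n) -card_draws mulnC -sum_nat_const big_mkcond /=.
  apply: leq_sum => C _; rewrite inE; case: ifP => // cC.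
  apply: leq_trans (dense C (eqP cC)) _.
  rewrite -sum1_card big_mkcond /=; apply: leq_sum => k _.
  by rewrite inE /b cC; case: ifP.
rewrite exchange_big /=.
apply: (@leq_trans (\sum_(k < n) \sum_(A in F) (k \notin A))%N); last first.
  rewrite exchange_big /= -sum_nat_const; apply: leq_sum => A AF.
  have -> : (n - j.+1 = #|~: A|)%N by rewrite cardsCs setCK card_ord (cF A AF).
  rewrite -sum1_card [leqRHS]big_mkcond /=.
  by apply: leq_sum => k _; rewrite inE; case: ifP.
apply: leq_sum => k _.
have -> : (\sum_(A in F) (k \notin A) = #|[set A in F | k \notin A]|)%N.
  rewrite -sum1_card [RHS]big_mkcond [LHS]big_mkcond; apply: eq_bigr => A _.
  by rewrite inE; case: ifP => // _; case: ifP.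
have -> : (\sum_(C : {set 'I_n}) b C k = #|[set C | b C k]|)%N.
  rewrite -sum1_card [RHS]big_mkcond; apply: eq_bigr => C _.
  by rewrite inE; case: ifP.
rewrite -(card_in_imset (f := fun C => C :\ k)) => [|C C']; last first.
  rewrite !inE => /and3P[_ kC _] /and3P[_ kC' _] /(congr1 (setU [set k])).
  by rewrite !setD1K.
apply/subset_leq_card/subsetP => A /imsetP[C]; rewrite inE => /and3P[_ kC CF] ->.
by rewrite inE CF !inE eqxx.
Qed.

(** At D :\ ord0, the boundary of the boundary has a single term in which the
added set contains [ord0], namely the one at D. *)
Lemma boundary_eq0_cone (R : comNzRingType) n j (v : {set 'I_n.+1} -> R) :
    (forall D : {set 'I_n.+1}, #|D| = j -> ord0 \notin D -> boundary v D = 0) ->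
  forall D : {set 'I_n.+1}, #|D| = j -> boundary v D = 0.
Proof.
move=> v0 D cD; have [D0|] := boolP (ord0 \in D); last exact: v0.
have /eqP := boundary_boundary v (D :\ ord0).
rewrite {1}/boundary (bigD1 ord0) /=; last by rewrite !inE eqxx.
rewrite setD1K // big1 => [|k /andP[kD k0]].
  by rewrite addr0 mulrI_eq0 => [/eqP//|]; apply/lregX/lregN/lreg1.
rewrite v0 ?mulr0 //.
  by rewrite cardsU1 kD -cD (cardsD1 ord0 D) D0.
by rewrite !inE eq_sym (negPf k0).
Qed.

(** By the cone lemma, the matrix that sends a chain on F to its boundary at the
sets avoiding [ord0] is already injective. *)
Lemma leq_card_acyclic (K : fieldType) n j (F : {set {set 'I_n.+1}}) :
    (forall v : {set 'I_n.+1} -> K, (forall A, A \notin F -> v A = 0) ->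
       (forall D : {set 'I_n.+1}, #|D| = j -> boundary v D = 0) -> forall A, v A = 0) ->
  (#|F| <= 'C(n, j))%N.
Proof.
move=> acyclic.
pose T := [set D : {set 'I_n.+1} | D \subset [set~ ord0] & #|D| == j].
have -> : 'C(n, j) = #|T| by rewrite cards_draws cardsC1 card_ord.
pose M : 'M[K]_(#|F|, #|T|) :=
  \matrix_(a, t) boundary (fun A => (A == enum_val a)%:R) (enum_val t).
suff /eqP <- : row_free M by exact: rank_leq_col.
rewrite -kermx_eq0; apply/rowV0P => r /sub_kermxP rM.
pose v A := \sum_a r 0 a * (A == enum_val a)%:R.
have v_enum a : v (enum_val a) = r 0 a.
  rewrite /v (bigD1 a) //= eqxx mulr1 big1 ?addr0 // => a' a'a.
  by rewrite (inj_eq enum_val_inj) eq_sym (negPf a'a) mulr0.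
suff v0 : forall A, v A = 0 by apply/rowP=> a; rewrite -v_enum v0 mxE.
apply: acyclic => [A AF|].
  rewrite /v big1 // => a _; case: eqP => [eA|]; last by rewrite mulr0.
  by rewrite eA enum_valP in AF.
apply: boundary_eq0_cone => D cD D0.
have DT : D \in T by rewrite inE cD eqxx subsetC sub1set inE D0.
have /matrixP/(_ 0 (enum_rank_in DT D)) := rM.
rewrite !mxE => <-; under [RHS]eq_bigr do rewrite mxE enum_rankK_in // mulr_sumr.
rewrite exchange_big; apply: eq_bigr => k _.
by rewrite mulr_sumr; apply: eq_bigr => a _; rewrite mulrCA.
Qed.

(** Multiplying the coordinate at A by the product of the variables outside A
turns the simplicial chain v into a Koszul chain homogeneous of multidegree
(1, ..., 1), whose differential is the boundary of v rescaled likewise. *)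
Lemma acyclic_supported (K : fieldType) n j (B : {set jsubset n j.+1}) :
    (forall w : koszul K n j.+1, supported B w -> koszul_d w = 0 -> w = 0) ->
  forall v : {set 'I_n} -> K, (forall A, A \notin faces B -> v A = 0) ->
    (forall D : {set 'I_n}, #|D| = j -> boundary v D = 0) -> forall A, v A = 0.
Proof.
move=> inj_d v vB dv A.
have [cA|cA] := eqVneq #|A| j.+1; last first.
  by apply: vB; apply: contraNN cA => /card_faces ->.
pose f E : {mpoly K[n]} := v E *: 'X_[indicator (~: E)].
have w0 : chain j.+1 f = 0.
  apply: inj_d => [E EB|].
    have [cE|cE] := eqVneq #|E| j.+1; last exact: kcoef_card.
    by apply: etrans (kcoef_chain f cE) _; rewrite /f vB // scale0r.
  apply: (@kcoefP _ _ j) => D; apply: etrans _ (esym (@kcoef0 K n j D)).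
  have [cD|cD] := eqVneq #|D| j; last exact: kcoef_card.
  apply: etrans (kcoef_koszul_d _ cD) _.
  rewrite -[RHS](scale0r 'X_[indicator (~: D)]) -(dv D cD) scaler_suml.
  apply: eq_bigr => k kD.
  have -> : kcoef (chain j.+1 f) (k |: D) = f (k |: D).
    by apply: kcoef_chain; rewrite cardsU1 kD cD.
  have -> : ~: D = k |: ~: (k |: D).
    by apply/setP=> x; rewrite !inE; case: (x =P k) => [->|].
  rewrite indicatorU1 ?inE ?eqxx // mpolyXD -!mul_mpolyC mpolyCM rmorph_sign.
  by rewrite /f -mul_mpolyC -!mulrA; congr (_ * _); rewrite mulrCA.
have : f A = 0.
  apply: etrans (esym (kcoef_chain f cA)) _.
  apply: etrans (congr1 (fun w : koszul K n j.+1 => kcoef w A) w0) _.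
  exact: kcoef0.
move=> /(congr1 (mcoeff (indicator (~: A)))).
by rewrite mcoeffZ mcoeffX eqxx mulr1 mcoeff0.
Qed.

(** * The bound on the number of variables *)

Lemma bourbaki_bound (K : fieldType) n j :
    has_multigraded_bourbaki_sequence K n j.+1 -> (j.+1 < n)%N ->
  (j * n <= j.+1 * j.+2)%N.
Proof.
case: n => // n /bourbaki_ideal_map[B [inj_d [phi phiP]]] jn.
have le1 := leq_card_acyclic (acyclic_supported inj_d).
have le2 := leq_faces_double_count (@card_faces _ _ B) (card_faces_in phiP).
have e1 := mul_bin_diag n.+1 j; have e2 := mul_bin_left n.+1 j.+1.
have C0 : (0 < 'C(n, j))%N by rewrite bin_gt0; lia.
rewrite /= in e1.
have {le1 le2} le : (j * 'C(n.+1, j.+2) <= 'C(n, j) * (n.+1 - j.+1))%N.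
  by apply: leq_trans le2 _; rewrite leq_mul2r le1 orbT.
(* Times this positive factor, the claim is j.+1 * j.+2 times [le]. *)
have N0 : (0 < 'C(n, j) * (n.+1 - j.+1))%N by rewrite muln_gt0 C0 subn_gt0.
rewrite -(leq_pmul2r N0).
have -> : (j * n.+1 * ('C(n, j) * (n.+1 - j.+1))
           = j.+1 * j.+2 * (j * 'C(n.+1, j.+2)))%N.
  transitivity (j * (n.+1 - j.+1) * (n.+1 * 'C(n, j)))%N; first by ring.
  rewrite e1; transitivity (j * j.+1 * ((n.+1 - j.+1) * 'C(n.+1, j.+1)))%N.
    by ring.
  by rewrite -e2; ring.
by rewrite leq_mul2l le orbT.
Qed.

Local Close Scope ring_scope.

Theorem corollary5p5 (K : fieldType) :
  (forall i : nat, 2 <= i ->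
     exists n0 : nat, forall n : nat, n0 <= n ->
       ~ has_multigraded_bourbaki_sequence K n i) /\
  (forall j : nat, 3 <= j ->
     exists n0 : nat, forall n : nat, n0 <= n ->
       ~ has_multigraded_bourbaki_sequence K n (n - j)).
Proof.
split=> [[//|i] i2 | j j3].
  exists (i.+1 * i.+2).+1 => n n0 /bourbaki_bound le.
  by have := le _; nia.
exists (j * j).+1 => n n0.
have [i ni] : exists i, n - j = i.+1 by exists (n - j.+1); nia.
rewrite ni => /bourbaki_bound le.
have := le _; nia.
Qed.
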